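(* Let $A^{(0)}=B^{(0)}\in S_{d,K}$ be the same input matrix, and let $\{A^{(r)}\}_r$ and $\{B^{(r)}\}_r$ be generated by the schemes $$A^{(r+1)} = \Pi_{S_{d,K}}\bigl(C_{A^{(r)}}A^{(r)}S_{A^{(r)}}^{-1}\bigr) = C_{A^{(r)}}A^{(r)}S_{A^{(r)}}^{-1}\Bigl(S_{A^{(r)}}^{-1}(A^{(r)})^{\mathrm T}C_{A^{(r)}}^2A^{(r)}S_{A^{(r)}}^{-1}\Bigr)^{-1/2}$$ and $$B^{(r+1)} = \Pi_{S_{d,K}}\bigl(C_{B^{(r)}}B^{(r)}\bigr) = C_{B^{(r)}}B^{(r)}\Bigl((B^{(r)})^{\mathrm T}C_{B^{(r)}}^2B^{(r)}\Bigr)^{-1/2},$$ respectively, where the iterates are assumed not to lie in $\mathcal A$ so that the schemes are defined. Then the iterates coincide on the Grassmannian $G_{d,K}$, i.e. $[A^{(r)}]=[B^{(r)}]$ for all $r$; equivalently, the columns of $A^{(r)}$ and of $B^{(r)}$ span the same subspace of $\mathbb R^d$.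
   Context: Let $1\le K\le d$, $N\ge d$, and let $y_1,\dots,y_N\in\mathbb R^d$ be given data points. $\mathbb R^{d,K}$ denotes the real $d\times K$ matrices, $\|\cdot\|$ the Euclidean norm of vectors and the Frobenius norm of matrices. The Stiefel manifold is $S_{d,K}=\{A\in\mathbb R^{d,K}: A^{\mathrm T}A=I_K\}$, and the Grassmannian is the quotient $G_{d,K}=S_{d,K}/O(K)$ with equivalence classes $[A]=\{AQ:Q\in O(K)\}$. For $A\in\mathbb R^{d,K}$ put $P_A^\perp = I_d-AA^{\mathrm T}$. The anchor set is $\mathcal A=\{A\in S_{d,K}:\|P_A^\perp y_i\|=0\text{ for some }i\in\{1,\dots,N\}\}$. For $A\in S_{d,K}\setminus\mathcal A$ put $C_A=\sum_{i=1}^N \frac{y_iy_i^{\mathrm T}}{\|P_A^\perp y_i\|}$ and $S_A=A^{\mathrm T}C_AA\in\mathbb R^{K,K}$. $\Pi_{S_{d,K}}(M)=\operatorname{argmin}_{O\in S_{d,K}}\|M-O\|^2$ is the orthogonal projection onto $S_{d,K}$; for $M$ of full rank, $\Pi_{S_{d,K}}(M)=M(M^{\mathrm T}M)^{-1/2}$. Standing assumption: the matrices $S_A$ at the iterates are invertible, so that the schemes are well defined. *)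

(* Defs.v *)
From HB Require Import structures.
From mathcomp Require Import all_boot all_order all_algebra.
From mathcomp Require Import boolp classical_sets reals.

Set Implicit Arguments.
Unset Strict Implicit.
Unset Printing Implicit Defensive.

Import Order.TTheory GRing.Theory Num.Theory.
Local Open Scope classical_set_scope.
Local Open Scope ring_scope.

(* On column vectors, i.e. n = 1, this is the Euclidean norm. *)
Definition fnorm (R : realType) (m n : nat) (M : 'M[R]_(m, n)) : R :=
  Num.sqrt (\sum_(i < m) \sum_(j < n) M i j ^+ 2).

Definition stiefel (R : realType) (d K : nat) : set 'M[R]_(d, K) :=
  [set A | A^T *m A = 1%:M].

Definition orthogonal_group (R : realType) (K : nat) : set 'M[R]_K :=
  [set Q | Q^T *m Q = 1%:M].

Definition grass_class (R : realType) (d K : nat) (A : 'M[R]_(d, K)) :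
    set 'M[R]_(d, K) :=
  [set A *m Q | Q in @orthogonal_group R K].

(* Set-valued argmin; no existence or uniqueness of minimizers is built in. *)
Definition stiefel_proj (R : realType) (d K : nat) (M : 'M[R]_(d, K)) :
    set 'M[R]_(d, K) :=
  [set O | stiefel O /\
           forall O' : 'M[R]_(d, K), stiefel O' ->
             fnorm (M - O) ^+ 2 <= fnorm (M - O') ^+ 2].

Definition posdefmx (R : realType) (n : nat) (X : 'M[R]_n) : Prop :=
  X^T = X /\ forall v : 'cV[R]_n, v != 0 -> 0 < (v^T *m X *m v) 0 0.

(* G ^ (-1/2): the symmetric positive definite X with X ^ 2 = G ^ (-1).
   The junk value 0 is taken when there is no such X, that is when G is not
   symmetric positive definite. *)
Definition invsqrtmx (R : realType) (n : nat) (G : 'M[R]_n) : 'M[R]_n :=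
  xget 0 [set X : 'M[R]_n | posdefmx X /\ G *m (X *m X) = 1%:M].

Definition perp_proj (R : realType) (d K : nat) (A : 'M[R]_(d, K)) : 'M[R]_d :=
  1%:M - A *m A^T.

Section Data.
Variables (R : realType) (d K N : nat) (y : 'I_N -> 'cV[R]_d).

Definition anchor_set : set 'M[R]_(d, K) :=
  [set A | stiefel A /\ exists i : 'I_N, fnorm (perp_proj A *m y i) = 0].

Definition Cmx (A : 'M[R]_(d, K)) : 'M[R]_d :=
  \sum_(i < N) (fnorm (perp_proj A *m y i))^-1 *: (y i *m (y i)^T).

Definition Smx (A : 'M[R]_(d, K)) : 'M[R]_K := A^T *m Cmx A *m A.

End Data.

(* Main.v *)
Require Import Defs.
From HB Require Import structures.
From mathcomp Require Import all_boot all_order all_algebra.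
From mathcomp Require Import boolp classical_sets reals.
From mathcomp Require Import ring.

(** The iterates coincide on the Grassmannian because right multiplication by
    an invertible [K x K] matrix changes neither the column space nor,
    consequently, the class of the orthonormalised matrix: [C_A] depends on [A]
    only through [A A^T], hence only through [[A]], and the two schemes
    orthonormalise [C_A A S_A^-1] and [C_A A], which differ by such a factor.

    The work lies in identifying the projection.  The projection is only known
    as a minimiser [O] of [|M - O'|^2], that is as a maximiser of
    [tr (O'^T M)] over the Stiefel manifold.  Comparing [O] with [U O], for [U]
    orthogonal, shows that [W = M O^T] maximises [U |-> tr (U^T W)] at
    [U = 1].  Testing this with one reflection gives [v^T W v >= 0], and with a
    product of two reflections along nearby vectors, to first order in their
    distance, that [W] is symmetric ([trace_maximal_psd]).  It follows that
    [M = O Z] with [Z = O^T M] symmetric positive semidefinite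
    ([stiefel_proj_polar]): the minimiser itself supplies the polar
    decomposition, so that no spectral theorem is needed for the existence of
    the square root of [M^T M].  When [M] has full column rank [Z] is positive
    definite, and [Z^-1] is the inverse square root of [M^T M] since positive
    definite square roots are unique ([posdefmx_sqr_inj]). *)

Set Implicit Arguments.
Unset Strict Implicit.
Unset Printing Implicit Defensive.

Import Order.TTheory GRing.Theory Num.Theory.
Local Open Scope classical_set_scope.
Local Open Scope ring_scope.

(** * Bilinear forms and positive semidefinite matrices *)

Definition bform (R : realType) (n : nat) (W : 'M[R]_n) (u v : 'cV[R]_n) : R :=
  (u^T *m W *m v) 0 0.

Definition psdmx (R : realType) (n : nat) (W : 'M[R]_n) : Prop :=
  W^T = W /\ forall v : 'cV[R]_n, 0 <= bform W v v.

Section BilinearForms.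
Variables (R : realType) (n : nat).
Implicit Types (W X Y : 'M[R]_n) (u v w : 'cV[R]_n).

Lemma mxtrace_outer W u v : \tr (u *m v^T *m W) = bform W v u.
Proof. by rewrite -mulmxA mxtrace_mulC trace_mx11. Qed.

Lemma bformDl W u v w : bform W (u + v) w = bform W u w + bform W v w.
Proof. by rewrite /bform linearD /= !mulmxDl mxE. Qed.

Lemma bformDr W u v w : bform W u (v + w) = bform W u v + bform W u w.
Proof. by rewrite /bform mulmxDr mxE. Qed.

Lemma bformZl W a u v : bform W (a *: u) v = a * bform W u v.
Proof. by rewrite /bform linearZ /= -!scalemxAl mxE. Qed.

Lemma bformZr W a u v : bform W u (a *: v) = a * bform W u v.
Proof. by rewrite /bform -scalemxAr mxE. Qed.

Lemma bform_tr W u v : bform W^T u v = bform W v u.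
Proof.
transitivity ((v^T *m W *m u)^T 0 0); last by rewrite mxE.
by rewrite /bform !trmx_mul trmxK mulmxA.
Qed.

Lemma bform_delta W i j : bform W (delta_mx i 0) (delta_mx j 0) = W i j.
Proof. by rewrite /bform trmx_delta -rowE -colE !mxE. Qed.

Lemma bform1_delta_gt0 (i : 'I_n) :
  0 < bform 1%:M (delta_mx i 0) (delta_mx i 0) :> R.
Proof. by rewrite bform_delta mxE eqxx. Qed.

Lemma bform1E u : bform 1%:M u u = \sum_i u i 0 ^+ 2.
Proof.
rewrite /bform mulmx1 mxE; apply: eq_bigr => i _.
by rewrite mxE expr2.
Qed.

Lemma bform1_ge0 u : 0 <= bform 1%:M u u.
Proof. by rewrite bform1E; apply: sumr_ge0 => i _; rewrite sqr_ge0. Qed.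

Lemma bform1_eq0 u : (bform 1%:M u u == 0) = (u == 0).
Proof.
apply/eqP/eqP => [|->]; last by rewrite /bform mulmx0 mxE.
rewrite bform1E => /eqP; rewrite psumr_eq0 => [/allP u0|i _]; last exact: sqr_ge0.
apply/colP => i; rewrite mxE; apply/eqP; rewrite -sqrf_eq0.
by apply: u0; rewrite mem_index_enum.
Qed.

Lemma bform1_gt0 u : (0 < bform 1%:M u u) = (u != 0).
Proof. by rewrite lt_neqAle bform1_ge0 andbT eq_sym bform1_eq0. Qed.

Lemma bform1C u v : bform 1%:M u v = bform 1%:M v u :> R.
Proof. by rewrite -bform_tr trmx1. Qed.

End BilinearForms.

(** The first-order condition at a minimum, for a quadratic function. *)
Lemma quadratic_ge0_linear_coef (R : realType) (a b : R) :
  (forall t, 0 <= t * a + t ^+ 2 * b) -> a = 0.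
Proof.
(* The value is negative at [t = - a s] as soon as [b s < 1]. *)
move=> ge0; set s := (`|b| + 1)^-1.
have b1_gt0 : 0 < `|b| + 1 by rewrite ltr_pwDr.
have s_gt0 : 0 < s by rewrite invr_gt0.
have bs_lt1 : b * s < 1.
  by rewrite ltr_pdivrMr // mul1r (le_lt_trans (ler_norm b)) // ltrDl.
have := ge0 (- a * s).
have -> : - a * s * a + (- a * s) ^+ 2 * b = - (a ^+ 2 * (s * (1 - b * s))).
  by ring.
have c_gt0 : 0 < s * (1 - b * s) by rewrite mulr_gt0 // subr_gt0.
rewrite oppr_ge0 pmulr_lle0 // => a2_le0.
by apply/eqP; rewrite -sqrf_eq0 eq_le a2_le0 sqr_ge0.
Qed.

Section PositiveMatrices.
Variables (R : realType) (n : nat).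
Implicit Types (X Y Z : 'M[R]_n).

(** An isotropic vector of a positive semidefinite form minimises it, hence
    lies in its radical, which is zero when the matrix is invertible. *)
Lemma psdmx_unit_posdef Z : psdmx Z -> Z \in unitmx -> posdefmx Z.
Proof.
move=> [symZ Z_ge0] Zu; split=> // v v_neq0.
rewrite -/(bform Z v v) lt_neqAle Z_ge0 andbT eq_sym.
apply: contraNneq v_neq0 => v_iso.
suff Zv0 : Z *m v = 0 by rewrite -[v](mulKmx Zu) Zv0 mulmx0.
apply/colP => i; rewrite [RHS]mxE.
have -> : (Z *m v) i 0 = bform Z (delta_mx i 0) v.
  by rewrite /bform trmx_delta -mulmxA -rowE [in RHS]mxE.
set w := delta_mx i 0.
suff : 2 * bform Z w v = 0 by move=> /eqP; rewrite mulf_eq0 pnatr_eq0 => /eqP.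
apply: (@quadratic_ge0_linear_coef _ _ (bform Z w w)) => t.
have := Z_ge0 (v + t *: w).
rewrite !(bformDl, bformDr, bformZl, bformZr) v_iso.
rewrite -(bform_tr Z w v) symZ.
by congr (0 <= _); ring.
Qed.

Lemma posdefmx_inv Z : posdefmx Z -> Z \in unitmx -> posdefmx (invmx Z).
Proof.
move=> [symZ Z_gt0] Zu; split=> [|v v_neq0]; first by rewrite trmx_inv symZ.
have w_neq0 : invmx Z *m v != 0.
  by apply: contraNneq v_neq0 => w0; rewrite -[v](mulKVmx Zu) w0 mulmx0.
have := Z_gt0 _ w_neq0.
by rewrite trmx_mul trmx_inv symZ -!mulmxA mulKVmx.
Qed.

Lemma mxtrace_congr (m : nat) X (D : 'M[R]_(n, m)) :
  \tr (D^T *m X *m D) = \sum_j bform X (col j D) (col j D).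
Proof.
apply: eq_bigr => j _.
by rewrite -[LHS]bform_delta /bform !colE trmx_mul !mulmxA.
Qed.

Lemma posdefmx_bform_ge0 X (v : 'cV[R]_n) : posdefmx X -> 0 <= bform X v v.
Proof.
case=> _ X_gt0; have [->|/X_gt0/ltW//] := eqVneq v 0.
by rewrite /bform mulmx0 mxE.
Qed.

Lemma posdefmx_trace_ge0 (m : nat) X (D : 'M[R]_(n, m)) :
  posdefmx X -> 0 <= \tr (D^T *m X *m D).
Proof.
move=> Xp; rewrite mxtrace_congr; apply: sumr_ge0 => j _.
exact: posdefmx_bform_ge0.
Qed.

Lemma posdefmx_trace_eq0 (m : nat) X (D : 'M[R]_(n, m)) :
  posdefmx X -> \tr (D^T *m X *m D) = 0 -> D = 0.
Proof.
move=> Xp /eqP; rewrite mxtrace_congr psumr_eq0; last first.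
  by move=> j _; apply: posdefmx_bform_ge0.
move=> /allP D0; apply/matrixP => i j.
have /eqP : col j D = 0.
  apply/eqP/contraT => /(proj2 Xp).
  by have /eqP := D0 j (mem_index_enum j); rewrite /bform => ->; rewrite ltxx.
by move=> /eqP/colP/(_ i); rewrite !mxE.
Qed.

(** With [D = X - Y] one has [X D + D Y = X^2 - Y^2 = 0]; multiplying by [D]
    and taking traces gives [tr (D X D) + tr (D Y D) = 0], a sum of nonnegative
    terms, the first of which vanishes only for [D = 0]. *)
Lemma posdefmx_sqr_inj X Y :
  posdefmx X -> posdefmx Y -> X *m X = Y *m Y -> X = Y.
Proof.
move=> Xp Yp eqXY; set D := X - Y.
have symD : D^T = D by rewrite /D linearB /= (proj1 Xp) (proj1 Yp).
have DXY : X *m D + D *m Y = 0.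
  by rewrite /D mulmxBr mulmxBl eqXY addrA subrK subrr.
have tr0 : \tr (D^T *m X *m D) + \tr (D^T *m Y *m D) = 0.
  rewrite symD [X in _ + X]mxtrace_mulC -!mulmxA -linearD /=.
  by rewrite -mulmxDr DXY mulmx0 linear0.
have trX := posdefmx_trace_ge0 D Xp; have trY := posdefmx_trace_ge0 D Yp.
apply/eqP; rewrite -subr_eq0; apply/eqP/(posdefmx_trace_eq0 Xp); rewrite -/D.
by apply/eqP; rewrite eq_le trX andbT -tr0 lerDl.
Qed.

Lemma invsqrtmxE G X : posdefmx X -> G *m (X *m X) = 1%:M -> invsqrtmx G = X.
Proof.
move=> Xp GX; rewrite /invsqrtmx; case: xgetP => [Y _ [Yp GY]|/(_ X)[]//].
apply: posdefmx_sqr_inj => //.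
have Gu : G \in unitmx by case/mulmx1_unit: GX.
by rewrite -[LHS](mulKmx Gu) GY -GX mulKmx.
Qed.

End PositiveMatrices.

(** * Trace maximality over the orthogonal group *)

(** For [v = 0] this is the identity, because [0^-1 = 0]. *)
Definition reflmx (R : realType) (n : nat) (v : 'cV[R]_n) : 'M[R]_n :=
  1%:M - (2 / bform 1%:M v v) *: (v *m v^T).

Section TraceMaximal.
Variables (R : realType) (n : nat).
Implicit Types (W U : 'M[R]_n) (u v : 'cV[R]_n).

Lemma tr_reflmx v : (reflmx v)^T = reflmx v.
Proof. by rewrite /reflmx linearB /= trmx1 linearZ /= trmx_mul trmxK. Qed.

Lemma reflmxK v : reflmx v *m reflmx v = 1%:M.
Proof.
have [->|v_neq0] := eqVneq v 0.
  by rewrite /reflmx mul0mx scaler0 subr0 mulmx1.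
have q_neq0 : bform 1%:M v v != 0 by rewrite bform1_eq0.
rewrite /reflmx; set q := bform _ _ _ in q_neq0 *; set P := v *m v^T.
have PP : P *m P = q *: P.
  rewrite /P mulmxA -(mulmxA v) [v^T *m v]mx11_scalar.
  by rewrite mul_mx_scalar -scalemxAl /q /bform mulmx1.
rewrite mulmxBl mul1mx mulmxBr mulmx1 -scalemxAl -scalemxAr PP.
by apply/matrixP => i j; rewrite !mxE; field.
Qed.

Lemma reflmx_orthogonal v : orthogonal_group (reflmx v).
Proof. by rewrite /orthogonal_group /= tr_reflmx reflmxK. Qed.

Lemma mxtrace_reflmx_mul W v :
  \tr (reflmx v *m W) = \tr W - 2 / bform 1%:M v v * bform W v v.
Proof.
by rewrite /reflmx mulmxBl mul1mx linearB /= -scalemxAl linearZ /= mxtrace_outer.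
Qed.

Lemma bform_reflmx_mul W u v : bform (reflmx v *m W) u u =
  bform W u u - 2 / bform 1%:M v v * (bform 1%:M u v * bform W v u).
Proof.
have rank1 : u^T *m (v *m v^T *m W) *m u = bform 1%:M u v *: (v^T *m W *m u).
  rewrite -mul_scalar_mx /bform mulmx1 -mx11_scalar.
  by rewrite !mulmxA.
rewrite /reflmx; move: (2 / _) (bform 1%:M u v) rank1 => c s rank1.
rewrite /bform mulmxBl mul1mx mulmxBr mulmxBl -scalemxAl -scalemxAr -scalemxAl.
by rewrite rank1; move: (_ *m u) (v^T *m W *m u) => a b; rewrite !mxE.
Qed.

Section Maximal.
Variable W : 'M[R]_n.
Hypothesis maxW : forall U, orthogonal_group U -> \tr (U^T *m W) <= \tr W.

Lemma trace_maximal_bform_ge0 v : 0 <= bform W v v.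
Proof.
have [->|v_neq0] := eqVneq v 0; first by rewrite /bform mulmx0 mxE.
have q_gt0 : 0 < bform 1%:M v v by rewrite bform1_gt0.
have := maxW (reflmx_orthogonal v).
rewrite tr_reflmx mxtrace_reflmx_mul gerBl pmulr_rge0 //.
by rewrite divr_gt0.
Qed.

(** Maximality tested on the product of the reflections along [u] and [v].
    Once cleared of denominators the inequality also holds for zero vectors, so
    that [v] may then vary along a whole line. *)
Lemma trace_maximal_two_reflections u v :
  0 <= bform W u u * bform 1%:M v v + bform W v v * bform 1%:M u u
       - 2 * bform 1%:M u v * bform W v u.
Proof.
have form0 (X : 'M[R]_n) w : bform X 0 w = 0.
  by rewrite /bform trmx0 !mul0mx mxE.
have form0r (X : 'M[R]_n) w : bform X w 0 = 0 by rewrite /bform mulmx0 mxE.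
have [->|u_neq0] := eqVneq u 0.
  by rewrite !(form0, form0r) !(mul0r, mulr0) addr0 subr0.
have [->|v_neq0] := eqVneq v 0.
  by rewrite !(form0, form0r) !(mul0r, mulr0) addr0 subr0.
have qu : 0 < bform 1%:M u u by rewrite bform1_gt0.
have qv : 0 < bform 1%:M v v by rewrite bform1_gt0.
have orthU : orthogonal_group (reflmx v *m reflmx u).
  rewrite /orthogonal_group /= trmx_mul !tr_reflmx mulmxA -(mulmxA (reflmx u)).
  by rewrite reflmxK mulmx1 reflmxK.
have := maxW orthU.
rewrite trmx_mul !tr_reflmx -mulmxA !mxtrace_reflmx_mul bform_reflmx_mul.
rewrite -subr_ge0 => E_ge0.
have c_gt0 : 0 < 2 / (bform 1%:M u u * bform 1%:M v v) :> R.
  by rewrite divr_gt0 // mulr_gt0.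
rewrite -(pmulr_rge0 _ c_gt0); move: E_ge0; congr (0 <= _).
by field; rewrite !gt_eqF.
Qed.

(** Moving [v] away from [u] along [w], the product of the two reflections is a
    rotation close to the identity, and the first-order term of its trace
    against [W] is the antisymmetric part of [W]. *)
Lemma trace_maximal_bform_sym u w :
  0 < bform 1%:M u u -> bform W w u = bform W u w.
Proof.
move=> qu; apply/eqP; rewrite -subr_eq0.
have : bform 1%:M u u * (bform W u w - bform W w u) = 0.
  apply: (@quadratic_ge0_linear_coef _ _
    (bform W u u * bform 1%:M w w + bform W w w * bform 1%:M u u
     - 2 * bform 1%:M u w * bform W w u)) => t.
  have := trace_maximal_two_reflections u (u + t *: w).
  rewrite !(bformDl, bformDr, bformZl, bformZr) (bform1C w u).
  by congr (0 <= _); ring.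
by move=> /eqP; rewrite mulf_eq0 gt_eqF //= => /eqP e; rewrite -oppr_eq0 opprB e.
Qed.

Lemma trace_maximal_psd : psdmx W.
Proof.
split; last exact: trace_maximal_bform_ge0.
apply/matrixP => i j; rewrite mxE -!bform_delta.
exact/trace_maximal_bform_sym/bform1_delta_gt0.
Qed.

End Maximal.
End TraceMaximal.

(** * The projection onto the Stiefel manifold *)

Section StiefelProjection.
Variables (R : realType) (d K : nat).
Implicit Types (M O : 'M[R]_(d, K)).

Lemma fnorm_sqr M : fnorm M ^+ 2 = \tr (M^T *m M).
Proof.
rewrite /fnorm sqr_sqrtr; last first.
  by apply: sumr_ge0 => i _; apply: sumr_ge0 => j _; apply: sqr_ge0.
rewrite exchange_big /=; apply: eq_bigr => j _; rewrite mxE.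
by apply: eq_bigr => i _; rewrite mxE expr2.
Qed.

Lemma fnorm_sub_stiefel M O : stiefel O ->
  fnorm (M - O) ^+ 2 = \tr (M^T *m M) + \tr (1%:M : 'M[R]_K) - 2 * \tr (O^T *m M).
Proof.
move=> OO; rewrite fnorm_sqr [(M - O)^T]linearB /= mulmxBr !mulmxBl OO.
rewrite !linearB /= -[\tr (M^T *m O)]mxtrace_tr trmx_mul trmxK.
by ring.
Qed.

(** Every [U O] with [U] orthogonal competes with [O], so that [M O^T] is
    trace-maximal, hence symmetric positive semidefinite; compressing it by [O]
    gives [O^T M], and its symmetry gives [M = M O^T O = O M^T O]. *)
Lemma stiefel_proj_polar M O : stiefel_proj M O ->
  M = O *m (O^T *m M) /\ psdmx (O^T *m M).
Proof.
case=> OO minO; rewrite /stiefel /= in OO.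
have maxO U : orthogonal_group U -> \tr (U^T *m (M *m O^T)) <= \tr (M *m O^T).
  rewrite /orthogonal_group /= => UU.
  have UO : stiefel (U *m O).
    by rewrite /stiefel /= trmx_mul mulmxA -(mulmxA O^T) UU mulmx1.
  have := minO _ UO; rewrite !fnorm_sub_stiefel // lerD2l lerN2 ler_pM2l //.
  by rewrite trmx_mul mulmxA ![\tr (_ *m O^T)]mxtrace_mulC mulmxA.
have [symW W_ge0] := trace_maximal_psd maxO.
have MO : M *m O^T = O *m M^T by rewrite -symW trmx_mul trmxK.
have polar : M = O *m (M^T *m O) by rewrite mulmxA -MO -mulmxA OO mulmx1.
have symZ : M^T *m O = O^T *m M by rewrite [in RHS]polar mulmxA OO mul1mx.
split; first by rewrite -symZ.
split=> [|v]; first by rewrite trmx_mul trmxK symZ.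
have := W_ge0 (O *m v); congr (0 <= _ 0 0).
by rewrite trmx_mul -!mulmxA (mulmxA O^T O) OO mul1mx.
Qed.

(** Full column rank of [M] is expressed by a matrix [L] with [L M] invertible:
    for the two schemes the previous iterate, transposed, is such an [L]. *)
Lemma stiefel_proj_factor_unit (L : 'M[R]_(K, d)) M O :
  L *m M \in unitmx -> stiefel_proj M O -> O^T *m M \in unitmx.
Proof.
move=> LMu /stiefel_proj_polar[polar _]; move: LMu.
by rewrite {1}polar mulmxA unitmx_mul => /andP[].
Qed.

Lemma stiefel_projE (L : 'M[R]_(K, d)) M O :
  L *m M \in unitmx -> stiefel_proj M O -> O = M *m invsqrtmx (M^T *m M).
Proof.
move=> LMu projO; have [polar Z_psd] := stiefel_proj_polar projO.
have Zu := stiefel_proj_factor_unit LMu projO.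
move: (projO) Zu Z_psd polar => -[OO _].
move: (O^T *m M) => Z Zu Z_psd polar; have Z_pd := psdmx_unit_posdef Z_psd Zu.
rewrite (@invsqrtmxE _ _ _ (invmx Z)); last 2 first.
- exact: posdefmx_inv.
- rewrite polar trmx_mul (proj1 Z_pd) !mulmxA -(mulmxA Z) OO mulmx1.
  by rewrite mulmxK // mulmxV.
by rewrite polar mulmxK.
Qed.

(** The projection of [M] spans the column space of [M], which [M T] shares;
    two orthonormal frames of one space differ by an orthogonal matrix. *)
Lemma stiefel_proj_mulmxr (L : 'M[R]_(K, d)) M O O' (T : 'M[R]_K) :
  L *m (M *m T) \in unitmx -> stiefel_proj M O -> stiefel_proj (M *m T) O' ->
  exists2 Q : 'M[R]_K, orthogonal_group Q & O' = O *m Q.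
Proof.
move=> LMTu projO projO'.
have Zu := stiefel_proj_factor_unit LMTu projO'.
have [polar _] := stiefel_proj_polar projO.
have [polar' _] := stiefel_proj_polar projO'.
set Z' := O'^T *m _ in Zu polar'.
have eqO' : O' = O *m (O^T *m M *m T *m invmx Z').
  by rewrite !mulmxA -(mulmxA O) -polar polar' mulmxK.
exists (O^T *m M *m T *m invmx Z') => //.
move: (_ *m invmx Z') eqO' => Q eqO'.
have [[OO _] [OO' _]] := (projO, projO'); rewrite /stiefel /= in OO OO'.
by rewrite /orthogonal_group /= -OO' eqO' trmx_mul mulmxA -(mulmxA Q^T) OO mulmx1.
Qed.

End StiefelProjection.

(** * Grassmann classes and the weighted covariance matrix *)

Section GrassmannClasses.
Variables (R : realType) (d K : nat).
Implicit Types (A B : 'M[R]_(d, K)) (Q T : 'M[R]_K).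

Lemma orthogonal_group_mulmxr Q : orthogonal_group Q -> Q *m Q^T = 1%:M.
Proof. by rewrite /orthogonal_group /= => /mulmx1C. Qed.

Lemma grass_class_mulmx_sub A Q :
  orthogonal_group Q -> grass_class (A *m Q) `<=` grass_class A.
Proof.
move=> QQ _ [T TT <-]; exists (Q *m T); last by rewrite mulmxA.
by rewrite /orthogonal_group /= trmx_mul mulmxA -(mulmxA T^T) QQ mulmx1.
Qed.

Lemma mulmx_orthogonalK A Q : orthogonal_group Q -> A *m Q *m Q^T = A.
Proof. by move=> QQ; rewrite -mulmxA orthogonal_group_mulmxr // mulmx1. Qed.

Lemma grass_class_mulmx A Q :
  orthogonal_group Q -> grass_class (A *m Q) = grass_class A.
Proof.
move=> QQ; apply/seteqP; split; first exact: grass_class_mulmx_sub.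
rewrite -{1}(mulmx_orthogonalK A QQ); apply: grass_class_mulmx_sub.
by rewrite /orthogonal_group /= trmxK orthogonal_group_mulmxr.
Qed.

Lemma tr_mulmx_orthogonal_eqmx A Q :
  orthogonal_group Q -> ((A *m Q)^T == A^T)%MS.
Proof.
move=> QQ; apply/andP; split; first by rewrite trmx_mul submxMl.
by rewrite -{1}(mulmx_orthogonalK A QQ) [X in (X <= _)%MS]trmx_mul submxMl.
Qed.

Variables (N : nat) (y : 'I_N -> 'cV[R]_d).

Lemma tr_Cmx A : (Cmx y A)^T = Cmx y A.
Proof.
rewrite /Cmx linear_sum; apply: eq_bigr => i _.
by rewrite /= linearZ /= trmx_mul trmxK.
Qed.

Lemma tr_Smx A : (Smx y A)^T = Smx y A.
Proof. by rewrite /Smx !trmx_mul trmxK tr_Cmx mulmxA. Qed.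

Lemma Cmx_mulmx_orthogonal A Q : orthogonal_group Q -> Cmx y (A *m Q) = Cmx y A.
Proof.
by move=> QQ; rewrite /Cmx /perp_proj trmx_mul mulmxA mulmx_orthogonalK.
Qed.

End GrassmannClasses.

(** * The two schemes *)

Theorem lemma4p5 (R : realType) (d K N : nat)
    (hK : (1 <= K)%N) (hKd : (K <= d)%N) (hdN : (d <= N)%N)
    (y : 'I_N -> 'cV[R]_d) (A B : nat -> 'M[R]_(d, K))
    (hA0 : stiefel (A 0%N)) (hAB0 : A 0%N = B 0%N)
    (hAanchor : forall r : nat, ~ anchor_set y (A r))
    (hBanchor : forall r : nat, ~ anchor_set y (B r))
    (hAS : forall r : nat, Smx y (A r) \in unitmx)
    (hBS : forall r : nat, Smx y (B r) \in unitmx)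
    (hA : forall r : nat,
       stiefel_proj (Cmx y (A r) *m A r *m invmx (Smx y (A r))) (A r.+1))
    (hB : forall r : nat, stiefel_proj (Cmx y (B r) *m B r) (B r.+1)) :
  [/\ forall r : nat,
        A r.+1 = Cmx y (A r) *m A r *m invmx (Smx y (A r)) *m
                 invsqrtmx (invmx (Smx y (A r)) *m (A r)^T *m
                            (Cmx y (A r) *m Cmx y (A r)) *m
                            A r *m invmx (Smx y (A r))),
      forall r : nat,
        B r.+1 = Cmx y (B r) *m B r *m
                 invsqrtmx ((B r)^T *m (Cmx y (B r) *m Cmx y (B r)) *m B r),
      forall r : nat, grass_class (A r) = grass_class (B r)
    & forall r : nat, ((A r)^T == (B r)^T)%MS].
Proof.
have fullA r :
    (A r)^T *m (Cmx y (A r) *m A r *m invmx (Smx y (A r))) \in unitmx.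
  by rewrite !mulmxA -/(Smx y (A r)) mulmxV // unitmx1.
have fullB r : (B r)^T *m (Cmx y (B r) *m B r) \in unitmx.
  by rewrite mulmxA; apply: hBS.
have AB r : exists2 Q, orthogonal_group Q & A r = B r *m Q.
  elim: r => [|r [Q QQ eqA]].
    by exists 1%:M; rewrite ?mulmx1 // /orthogonal_group /= trmx1 mulmx1.
  have eqM : Cmx y (A r) *m A r *m invmx (Smx y (A r)) =
             Cmx y (B r) *m B r *m (Q *m invmx (Smx y (A r))).
    by rewrite {1 2}eqA Cmx_mulmx_orthogonal // !mulmxA.
  have := hA r; have := fullA r; rewrite eqM => fullM projM.
  exact: stiefel_proj_mulmxr fullM (hB r) projM.
split=> r.
- rewrite {1}(stiefel_projE (fullA r) (hA r)); congr (_ *m invsqrtmx _).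
  by rewrite !trmx_mul trmx_inv tr_Smx tr_Cmx !mulmxA.
- rewrite {1}(stiefel_projE (fullB r) (hB r)); congr (_ *m invsqrtmx _).
  by rewrite trmx_mul tr_Cmx !mulmxA.
- by have [Q QQ ->] := AB r; apply: grass_class_mulmx.
- by have [Q QQ ->] := AB r; apply: tr_mulmx_orthogonal_eqmx.
Qed.
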